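(* Let $\beta\in(0,1)$, let $S=\{\boldsymbol z_i\}_{i=1}^n$ be a finite data set, and let $f$ range over a class of functions with $f(\boldsymbol x)\in[0,1]$ for all $\boldsymbol x\in\mathcal X$. For $\kappa>0$ put $$\Delta_\kappa=\Big|\min_{f,(a,b)\in[0,1]^2}\max_{\gamma\in\Omega_\gamma}\min_{s'\in\Omega_{s'}}\hat{\mathbb E}_{\boldsymbol z\sim S}\big[G^\kappa_{op}(f,a,b,\gamma,\boldsymbol z,s')\big]-\min_{f,(a,b)\in[0,1]^2}\max_{\gamma\in\Omega_\gamma}\min_{s'\in\Omega_{s'}}\hat{\mathbb E}_{\boldsymbol z\sim S}\big[G_{op}(f,a,b,\gamma,\boldsymbol z,s')\big]\Big|,$$ where $\Omega_\gamma=[b-1,1]$ and $\Omega_{s'}=[0,5]$. Then $\lim_{\kappa\to\infty}\Delta_\kappa=0$, and moreover $\Delta_\kappa=O(1/\kappa)$.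
   Context: $\mathcal X\subseteq\mathbb R^d$; data points are $\boldsymbol z=(\boldsymbol x,y)\in\mathcal X\times\{0,1\}$; $p\in(0,1)$ is the proportion of positives, $p=\Pr[y=1]$; $\hat{\mathbb E}_{\boldsymbol z\sim S}[h(\boldsymbol z)]=\frac1n\sum_{i=1}^nh(\boldsymbol z_i)$. $$G_{op}(f,a,b,\gamma,\boldsymbol z,s')=\big[(f(\boldsymbol x)-a)^2-2(1+\gamma)f(\boldsymbol x)\big]\frac{y}{p}-\gamma^2+\Big(\beta s'+\big[(f(\boldsymbol x)-b)^2+2(1+\gamma)f(\boldsymbol x)-s'\big]_+\Big)\frac{1-y}{\beta(1-p)},$$ with $[u]_+=\max\{u,0\}$. $G^\kappa_{op}$ is obtained from $G_{op}$ by replacing $[\cdot]_+$ with the softplus function $r_\kappa(u)=\frac{\log(1+\exp(\kappa u))}{\kappa}$. A minimum over $f$ is understood as an infimum over the (nonempty) class considered. *)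

(* Defs.v *)
(* Built on MathComp-Analysis. *)
From HB Require Import structures.
From mathcomp Require Import all_boot all_order all_algebra.
From mathcomp Require Import all_classical all_reals all_analysis.
Set Implicit Arguments.
Unset Strict Implicit.
Unset Printing Implicit Defensive.
Import Order.TTheory GRing.Theory Num.Theory.
Import numFieldNormedType.Exports.
Local Open Scope classical_set_scope.
Local Open Scope ring_scope.

(* Lets the Landau notations be used at +oo. *)
Canonical pinfty_filter_on (R : numFieldType) :=
  FilterType (pinfty_nbhs R) _.

Definition pos_part {R : realType} (u : R) : R := Num.max u 0.

Definition softplus {R : realType} (kappa u : R) : R :=
  ln (1 + expR (kappa * u)) / kappa.

(* [r] is the function standing in the place of the positive part, so that
   [G_op] and its smoothed version differ only in [r]. In a data point
   [z = (x, y)], the label [y] is a boolean, read in [R] as 0 or 1. *)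
Definition G_with {R : realType} {T : Type} (r : R -> R) (beta p : R)
    (f : T -> R) (a b gamma : R) (z : T * bool) (s' : R) : R :=
  let: (x, y) := z in
  ((f x - a) ^+ 2 - 2 * (1 + gamma) * f x) * (y%:R / p) - gamma ^+ 2
  + (beta * s' + r ((f x - b) ^+ 2 + 2 * (1 + gamma) * f x - s'))
    * ((1 - y%:R) / (beta * (1 - p))).

Definition G_op {R : realType} {T : Type} (beta p : R) :=
  @G_with R T pos_part beta p.

Definition G_op_smooth {R : realType} {T : Type} (kappa beta p : R) :=
  @G_with R T (softplus kappa) beta p.

Definition emp_mean {R : realType} {Z : Type} (n : nat) (S : n.-tuple Z)
    (h : Z -> R) : R :=
  n%:R^-1 * \sum_(i < n) h (tnth S i).

(* min over f in F and (a, b) in [0, 1]^2 of the max over gamma in [b - 1, 1]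
   of the min over s' in [0, 5] of the empirical mean of G. The real-valued
   [inf] and [sup] are 0 by convention on sets that are empty or unbounded;
   for the functions G above and [0, 1]-valued f, all the sets involved are
   nonempty and bounded. The two inner extrema are those of continuous
   functions on compact intervals. *)
Definition minmaxmin {R : realType} {T : Type} (n : nat)
    (S : n.-tuple (T * bool)) (F : set (T -> R))
    (G : (T -> R) -> R -> R -> R -> T * bool -> R -> R) : R :=
  inf [set (let: (f, (a, b)) := w in
            sup [set inf [set emp_mean S (fun z => G f a b gamma z s')
                         | s' in `[0, 5]]
                | gamma in `[b - 1, 1]])
      | w in F `*` (`[0, 1] `*` `[0, 1])].

Definition Delta {R : realType} {T : Type} (n : nat)
    (S : n.-tuple (T * bool)) (F : set (T -> R)) (beta p kappa : R) : R :=
  `|minmaxmin S F (G_op_smooth kappa beta p) - minmaxmin S F (G_op beta p)|.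

(* Main.v *)
Require Import Defs.
From HB Require Import structures.
From mathcomp Require Import all_boot all_order all_algebra.
From mathcomp Require Import all_classical all_reals all_analysis.
From mathcomp Require Import ring lra.
Set Implicit Arguments.
Unset Strict Implicit.
Unset Printing Implicit Defensive.
Import Order.TTheory GRing.Theory Num.Theory.
Import numFieldNormedType.Exports.
Local Open Scope classical_set_scope.
Local Open Scope ring_scope.

(* Softplus exceeds the positive part by at most [ln 2 / kappa], uniformly.
   The empirical objective is Lipschitz in the function standing for the
   positive part, with constant [(beta * (1 - p))^-1], and infima and suprema
   of bounded functions are 1-Lipschitz for the uniform distance, so
   [Delta] is at most [ln 2 / (beta * (1 - p)) / kappa]. *)

(** * Softplus against the positive part *)

Lemma dist_softplus_pos_part (R : realType) (kappa u : R) :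
  0 < kappa -> `|softplus kappa u - pos_part u| <= ln 2 / kappa.
Proof.
move=> k0; rewrite /softplus /pos_part.
have e0 (x : R) : 0 < expR x := expR_gt0 x.
have lbn (a : R) : a <= ln (1 + expR a).
  rewrite -[leLHS]expRK ler_ln ?posrE ?addr_gt0 //.
  by rewrite lerDr.
have lb0 (a : R) : 0 <= ln (1 + expR a) by rewrite ln_ge0 // lerDl ltW.
(* Both upper bounds come from [1 + e^a <= 2 * max(1, e^a)]; the value at [a = 0] shows that [ln 2]
   is sharp. *)
have ub0 (a : R) : a <= 0 -> ln (1 + expR a) <= ln 2.
  move=> a0; rewrite ler_ln ?posrE ?addr_gt0 //.
  have : expR a <= expR 0 by rewrite ler_expR.
  by rewrite expR0; lra.
have ubn (a : R) : 0 <= a -> ln (1 + expR a) <= a + ln 2.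
  move=> a0; rewrite -[X in _ <= X + _]expRK -lnM ?posrE //.
  rewrite ler_ln ?posrE ?mulr_gt0 ?addr_gt0 //.
  have : expR 0 <= expR a by rewrite ler_expR.
  by rewrite expR0; lra.
set L := ln (1 + _).
(* The maximum with 0 is positively homogeneous, so [1 / kappa] factors out and only the sign of
   [kappa * u] matters. *)
have -> : L / kappa - Num.max u 0 = (L - Num.max (kappa * u) 0) / kappa.
  have -> : Num.max (kappa * u) 0 = kappa * Num.max u 0.
    by rewrite maxr_pMr ?mulr0 // ltW.
  by field; rewrite gt_eqF.
rewrite normrM normfV (gtr0_norm k0) ler_pM2r ?invr_gt0 // {}/L.
have [h|h] := leP (kappa * u) 0.
  by rewrite subr0 ger0_norm ?ub0.
by rewrite ger0_norm ?subr_ge0 ?lbn // lerBlDl ubn // ltW.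
Qed.

(** * Extrema of bounded functions *)

Section inf_sup_image.
Context {R : realType} {T : Type}.
Implicit Types (A : set T) (g h : T -> R).

(** Guarantees that [inf] is a true infimum and not its default value 0. *)
Lemma has_inf_image A h (M : R) : A !=set0 ->
  (forall x, A x -> `|h x| <= M) -> has_inf (h @` A).
Proof.
move=> [x Ax] hM; split; first by exists (h x), x.
by exists (- M) => _ [y Ay <-]; have := hM y Ay; rewrite ler_norml => /andP[].
Qed.

(** For nested extrema: the inner one, as a function of the outer variable, has to be bounded
    again. *)
Lemma normr_inf_image_le A h (M : R) : A !=set0 ->
  (forall x, A x -> `|h x| <= M) -> `|inf (h @` A)| <= M.
Proof.
move=> A0 hM; have hi := has_inf_image A0 hM.
rewrite ler_norml; apply/andP; split.
  apply: lb_le_inf; first exact: hi.1.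
  by move=> _ [y Ay <-]; have := hM y Ay; rewrite ler_norml => /andP[].
case: A0 => x Ax; apply: (le_trans (y := h x)).
  by apply: ge_inf; [exact: hi.2|exists x].
by have := hM x Ax; rewrite ler_norml => /andP[].
Qed.

(** Pointwise, [inf h - e <= h y - e <= g y], and the same with [g] and [h] exchanged. The bounds
    [M] and [N] make both infima genuine. *)
Lemma dist_inf_image_le A g h (M N e : R) : A !=set0 ->
  (forall x, A x -> `|g x| <= M) -> (forall x, A x -> `|h x| <= N) ->
  (forall x, A x -> `|g x - h x| <= e) ->
  `|inf (g @` A) - inf (h @` A)| <= e.
Proof.
move=> A0 gM hN gh.
have hg := has_inf_image A0 gM; have hh := has_inf_image A0 hN.
rewrite ler_norml; apply/andP; split.
  rewrite lerBrDl; apply: lb_le_inf; first exact: hg.1.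
  move=> _ [y Ay <-]; have := gh y Ay; rewrite ler_norml => /andP[+ _].
  have : inf (h @` A) <= h y by apply: ge_inf; [exact: hh.2|exists y].
  by lra.
rewrite lerBlDl -lerBlDr; apply: lb_le_inf; first exact: hh.1.
move=> _ [y Ay <-]; have := gh y Ay; rewrite ler_norml => /andP[_ +].
have : inf (g @` A) <= g y by apply: ge_inf; [exact: hg.2|exists y].
by lra.
Qed.

(** Holds for arbitrary sets, since [inf] is defined as the opposite of the [sup] of the opposite
    set; it carries the facts on infima over to suprema. *)
Lemma sup_image_opp A h : sup (h @` A) = - inf ((fun x => - h x) @` A).
Proof.
rewrite /inf opprK image_comp; congr (sup (_ @` A)).
by apply/funext => x /=; rewrite opprK.
Qed.

Lemma normr_sup_image_le A h (M : R) : A !=set0 ->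
  (forall x, A x -> `|h x| <= M) -> `|sup (h @` A)| <= M.
Proof.
move=> A0 hM; rewrite sup_image_opp normrN normr_inf_image_le // => x Ax.
by rewrite normrN hM.
Qed.

Lemma dist_sup_image_le A g h (M N e : R) : A !=set0 ->
  (forall x, A x -> `|g x| <= M) -> (forall x, A x -> `|h x| <= N) ->
  (forall x, A x -> `|g x - h x| <= e) ->
  `|sup (g @` A) - sup (h @` A)| <= e.
Proof.
move=> A0 gM hN gh; rewrite !sup_image_opp -opprD normrN.
apply: (dist_inf_image_le (M := M) (N := N)) => // x Ax; rewrite ?normrN ?gM ?hN //.
by rewrite -opprD normrN gh.
Qed.

End inf_sup_image.

(** * Stability of the min-max-min value *)

Section minmaxmin.
Context {R : realType} {T : Type} {n : nat}.
Context (S : n.-tuple (T * bool)) (F : set (T -> R)).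
Implicit Types G H : (T -> R) -> R -> R -> R -> T * bool -> R -> R.

Lemma dist_emp_mean_le (g h : T * bool -> R) (e : R) : (0 < n)%N ->
  (forall z, `|g z - h z| <= e) -> `|emp_mean S g - emp_mean S h| <= e.
Proof.
move=> n0 gh; have n0' : 0 < n%:R :> R by rewrite ltr0n.
rewrite /emp_mean -mulrBr -sumrB normrM normfV normr_nat ler_pdivrMl //.
apply: (le_trans (ler_norm_sum _ _ _)).
apply: (le_trans (ler_sum _ (fun i _ => gh (tnth S i)))).
by rewrite sumr_const card_ord mulr_natl.
Qed.

Lemma normr_emp_mean_le (h : T * bool -> R) (M : R) : (0 < n)%N ->
  (forall z, `|h z| <= M) -> `|emp_mean S h| <= M.
Proof.
move=> n0 hM; have := @dist_emp_mean_le h (fun=> 0) M n0.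
rewrite [emp_mean S (fun=> 0)]/emp_mean big1 // mulr0 subr0; apply=> z.
by rewrite subr0.
Qed.

(** The layers are peeled from the outside in: infimum, supremum, infimum, mean. Each passes on the
    error [e] unchanged, and also the bounds [M] and [N] that the layer around it requires. *)
Lemma dist_minmaxmin_le G H (M N e : R) : (0 < n)%N -> F !=set0 ->
  (forall f (a b gamma : R) z (s' : R), F f -> 0 <= a <= 1 -> 0 <= b <= 1 ->
    b - 1 <= gamma <= 1 -> 0 <= s' <= 5 ->
    [/\ `|G f a b gamma z s'| <= M, `|H f a b gamma z s'| <= N &
        `|G f a b gamma z s' - H f a b gamma z s'| <= e]) ->
  `|minmaxmin S F G - minmaxmin S F H| <= e.
Proof.
move=> n0 [f0 Ff0] GH.
have s0 : (`[0, 5] : set R) !=set0 by exists 0; rewrite /= in_itv /=; lra.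
have g0 (b : R) : 0 <= b <= 1 -> `[b - 1, 1] !=set0.
  by move=> b01; exists 1; rewrite /= in_itv /=; lra.
apply: (dist_inf_image_le (M := M) (N := N)).
- by exists (f0, (0, 0)); split => //=; rewrite !in_itv /=; lra.
- move=> [f [a b]] [/= Ff []]; rewrite !in_itv /= => a01 b01.
  apply: normr_sup_image_le; first exact: g0.
  move=> gamma; rewrite /= in_itv /= => gi.
  apply: normr_inf_image_le => // s'; rewrite /= in_itv /= => si.
  by apply: normr_emp_mean_le => // z; have [] := GH f a b gamma z s'.
- move=> [f [a b]] [/= Ff []]; rewrite !in_itv /= => a01 b01.
  apply: normr_sup_image_le; first exact: g0.
  move=> gamma; rewrite /= in_itv /= => gi.
  apply: normr_inf_image_le => // s'; rewrite /= in_itv /= => si.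
  by apply: normr_emp_mean_le => // z; have [] := GH f a b gamma z s'.
move=> [f [a b]] [/= Ff []]; rewrite !in_itv /= => a01 b01.
(* Interval membership computes to the two inequalities, so [GH] accepts [gi] and [si] directly. *)
have GHz gamma s' z : gamma \in `[b - 1, 1] -> s' \in `[0, 5] -> _ :=
  fun gi si => GH f a b gamma z s' Ff a01 b01 gi si.
apply: (dist_sup_image_le (M := M) (N := N)); first exact: g0.
- move=> gamma gi; apply: normr_inf_image_le => // s' si.
  by apply: normr_emp_mean_le => // z; have [] := GHz _ _ z gi si.
- move=> gamma gi; apply: normr_inf_image_le => // s' si.
  by apply: normr_emp_mean_le => // z; have [] := GHz _ _ z gi si.
move=> gamma gi; apply: (dist_inf_image_le (M := M) (N := N)) => // s' si.
- by apply: normr_emp_mean_le => // z; have [] := GHz _ _ z gi si.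
- by apply: normr_emp_mean_le => // z; have [] := GHz _ _ z gi si.
by apply: dist_emp_mean_le => // z; have [] := GHz _ _ z gi si.
Qed.

End minmaxmin.

(** * Estimates on the integrand *)

Section G_with.
Context {R : realType} {T : Type} (beta p : R).

(** Only the term [(r u - q u) * w] survives in the difference; the weight [w] is 0 on positives and
    [1 / (beta * (1 - p))] on negatives. *)
Lemma dist_G_with_le (r q : R -> R) (e : R) (f : T -> R) (a b gamma : R)
    (z : T * bool) (s' : R) :
  0 < beta < 1 -> 0 < p < 1 ->
  (forall u, `|r u - q u| <= e) ->
  `|G_with r beta p f a b gamma z s' - G_with q beta p f a b gamma z s'|
    <= e / (beta * (1 - p)).
Proof.
move=> beta01 p01 rq.
have D0 : 0 < beta * (1 - p) by apply: mulr_gt0; lra.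
case: z => x y; rewrite /G_with.
set u := _ - s'; set w := (1 - y%:R) / _; set c := _ - gamma ^+ 2.
have -> : c + (beta * s' + r u) * w - (c + (beta * s' + q u) * w)
    = (r u - q u) * w by ring.
rewrite normrM ler_pM // /w normrM normfV (gtr0_norm D0).
rewrite ler_piMl ?invr_ge0 ?(ltW D0) //.
by case: y {w c}; rewrite /= ?subrr ?normr0 ?subr0 ?normr1.
Qed.

(** Squares are at most 1 and [2 * (1 + gamma) * f x] lies in [[0, 4]], whence the first 5; the 10
    adds 5 for [beta * s'] and 5 for the positive part. Only finiteness matters: the bound does not
    enter the rate. *)
Lemma normr_G_op_le (f : T -> R) (a b gamma : R) (z : T * bool) (s' : R) :
  0 < beta < 1 -> 0 < p < 1 ->
  (forall x, 0 <= f x <= 1) -> 0 <= a <= 1 -> 0 <= b <= 1 ->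
  b - 1 <= gamma <= 1 -> 0 <= s' <= 5 ->
  `|G_op beta p f a b gamma z s'| <= 5 / p + 1 + 10 / (beta * (1 - p)).
Proof.
move=> beta01 p01 f01 a01 b01 g01 s01; case: z => x y; rewrite /G_op /G_with.
have D0 : 0 < beta * (1 - p) by apply: mulr_gt0; lra.
have p0 : 0 < p by lra.
have := f01 x; move: (f x) => t t01.
have sqr_le1 (v : R) : -1 <= v <= 1 -> 0 <= v ^+ 2 <= 1.
  by move=> v1; apply/andP; split; nra.
have tb := sqr_le1 (t - b); have ta := sqr_le1 (t - a).
have gt : 0 <= (1 + gamma) * t <= 2 by apply/andP; split; nra.
have bs : 0 <= beta * s' <= 5 by apply/andP; split; nra.
have {}tb : 0 <= (t - b) ^+ 2 <= 1 by apply: tb; lra.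
have {}ta : 0 <= (t - a) ^+ 2 <= 1 by apply: ta; lra.
have y01 : 0 <= (y%:R : R) <= 1 by case: y => /=; lra.
apply: (le_trans (ler_normD _ _)); apply: lerD.
  apply: (le_trans (ler_normB _ _)); apply: lerD.
    rewrite normrM ler_pM //; first by rewrite ler_norml; lra.
    rewrite normrM normfV (gtr0_norm p0) ler_piMl ?invr_ge0 ?(ltW p0) //.
    by rewrite ler_norml; lra.
  rewrite ler_norml; have : 0 <= gamma ^+ 2 <= 1 by apply: sqr_le1; lra.
  by lra.
rewrite normrM ler_pM //; last first.
  rewrite normrM normfV (gtr0_norm D0) ler_piMl ?invr_ge0 ?(ltW D0) //.
  by rewrite ler_norml; lra.
rewrite /pos_part; set u := _ - s'.
have : Num.max u 0 <= 5 by rewrite ge_max /u; apply/andP; split; lra.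
have : 0 <= Num.max u 0 by rewrite le_max lexx orbT.
by rewrite ler_norml; lra.
Qed.

End G_with.

(** * The explicit bound and its limit *)

Lemma Delta_le (R : realType) (T : Type) (F : set (T -> R)) (n : nat)
    (S : n.-tuple (T * bool)) (beta p kappa : R) :
  0 < beta < 1 -> 0 < p < 1 -> (0 < n)%N -> F !=set0 ->
  (forall f, F f -> forall x, 0 <= f x <= 1) -> 0 < kappa ->
  Delta S F beta p kappa <= ln 2 / (beta * (1 - p)) * kappa^-1.
Proof.
move=> beta01 p01 n0 F0 F01 k0.
set M := 5 / p + 1 + 10 / (beta * (1 - p)).
(* Regrouped so that [e] is the softplus error [ln 2 / kappa] times the largest weight. *)
rewrite mulrAC; set e := _ / (beta * (1 - p)).
apply: (dist_minmaxmin_le S (M := M + e) (N := M)) => //.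
move=> f a b gamma z s' Ff a01 b01 g01 s01.
have HM := normr_G_op_le z beta01 p01 (F01 f Ff) a01 b01 g01 s01.
have GH : `|G_op_smooth kappa beta p f a b gamma z s'
    - G_op beta p f a b gamma z s'| <= e.
  by apply: dist_G_with_le => // u; exact: dist_softplus_pos_part.
split => //.
(* The smoothed integrand is within [e] of one bounded by [M], hence bounded by [M + e]. *)
rewrite -[X in `|X|](subrK (G_op beta p f a b gamma z s')).
by apply: (le_trans (ler_normD _ _)); rewrite addrC lerD.
Qed.

Theorem theorem5 (R : realType) (d : nat) (X : set 'rV[R]_d)
  (F : set (X -> R)) (n : nat) (S : n.-tuple (X * bool)) (beta p : R)
  (beta01 : 0 < beta < 1) (p01 : 0 < p < 1) (n_gt0 : (0 < n)%N)
  (F_nonempty : F !=set0)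
  (F_01 : forall f, F f -> forall x, 0 <= f x <= 1) :
  Delta S F beta p kappa @[kappa --> +oo] --> (0 : R) /\
  Delta S F beta p =O_ +oo (fun kappa : R => kappa^-1).
Proof.
set C := ln 2 / (beta * (1 - p)).
have C0 : 0 < C.
  by rewrite divr_gt0 ?mulr_gt0 ?ln_gt0 ?ltr1n //; lra.
have DC kappa : 0 < kappa -> Delta S F beta p kappa <= C * kappa^-1.
  exact: Delta_le.
split.
  (* Squeeze between 0 and [C / kappa], valid once [kappa > 0]. *)
  apply: (@squeeze_cvgr _ _ _ _ (fun=> 0) (fun kappa => C * kappa^-1)).
  - near=> kappa; rewrite normr_ge0 DC //.
  - exact: cvg_cst.
  rewrite -[X in _ --> X](mulr0 C); apply: cvgM; first exact: cvg_cst.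
  apply/(@gtr0_cvgV0 _ _ _ _ (fun kappa : R => kappa)); last exact: cvg_id.
  exact: nbhs_pinfty_gt.
apply/eqO_exP; exists C => //; near=> kappa.
have k0 : 0 < kappa by [].
by rewrite /= ger0_norm ?normr_ge0 // gtr0_norm ?invr_gt0 // DC.
Unshelve. all: by end_near. Qed.
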